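(* For $|q|<1$ (equivalently, as formal power series in $q$), the following seven identities hold: \begin{align*} f_1^4f_6^2+f_2^2 f_3^4&=2\frac{f_1^2 f_4 f_6^9}{f_2 f_3^2 f_{12}^3},\\ f_2^2 f_3^4- f_1^4 f_6^2&= 4q\frac{f_1f_2^2f_3f_{12}^3}{f_4},\\ f_2^9f_3 f_{12}^2+2 f_1^3 f_4^6 f_6^3&=3 f_1^2 f_2^2 f_3^3 f_4^3 f_6 f_{12},\\ f_2^9 f_3 f_{12}^2-f_1^3 f_4^6 f_6^3&=3q f_1^3 f_2^2 f_4^2 f_6 f_{12}^4,\\ f_2^2f_3^3f_{12}-f_1f_4^3f_6^2&=q \frac{f_1f_2^2f_{12}^4}{f_4},\\ 2 f_1^2 f_3^2 f_4^3 f_6-f_2^7 f_{12}&=\frac{f_1^4 f_4^4 f_6^{10}}{f_2^3 f_3^4 f_{12}^3},\\ 4 f_3 f_4^3-f_1^3 f_{12}&=3\frac{f_2^2 f_3^4 f_{12}}{f_1 f_6^2}. \end{align*}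
   Context: For a positive integer $n$, $f_n:=(q^n;q^n)_\infty=\prod_{j=1}^\infty(1-q^{nj})$. *)

(* Defs.v *)
From HB Require Import structures.
From mathcomp Require Import all_boot all_order all_algebra.
From mathcomp Require Import all_classical all_reals all_analysis.
From mathcomp Require Import complex.
Set Implicit Arguments.
Unset Strict Implicit.
Unset Printing Implicit Defensive.
Import Order.TTheory GRing.Theory Num.Theory.
Import numFieldNormedType.Exports.
Local Open Scope classical_set_scope.
Local Open Scope ring_scope.

(* f_n = (q^n; q^n)_oo, with no side condition on q: [lim] is total, and the
   partial products converge when |q| < 1 and n > 0 (for K = R[i]). *)
Definition eulerf (K : numFieldType) (q : K) (n : nat) : K :=
  lim ((fun N : nat => \prod_(1 <= j < N.+1) (1 - q ^+ (n * j)) : K) @ \oo).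

(* Main.v *)
(* With p = q^6 put j(z) = (p;p)(z;p)(p/z;p). By Jacobi's triple product j(z) is a
   bilateral theta series, and splitting the double series j(xy)j(x/y) by the
   parity of the sum of the two indices writes it as a 2x2 determinant in two
   functions of x and y. The Pluecker relation between such determinants is
   Weierstrass' three-term relation
     j(xy)j(x/y)j(uv)j(u/v) - j(xv)j(x/v)j(uy)j(u/y) = (u/y) j(yv)j(y/v)j(xu)j(x/u).
   Each j(q^k), j(-q^k) is an eta quotient in f1, f2, f3, f4, f6, f12, and the
   substitutions
     (1, q^2, -q^2, -q^3), (q, q^3, -q^2, -q^3), (1, q^3, q, -q^2), (1, q^3, q^2, -q^2)
   for (x, y, u, v) give identities 1, 2, 5 and 6; the other three are linear
   combinations of these.
   The triple product itself is the limit of the finite q-binomial theorem, by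
   dominated convergence for unconditional sums over finite index sets. *)
Require Import Defs.
From HB Require Import structures.
From mathcomp Require Import all_boot all_order all_algebra.
From mathcomp Require Import all_classical all_reals all_analysis.
From mathcomp Require Import complex.
From mathcomp Require Import zify ring lra.
Set Implicit Arguments.
Unset Strict Implicit.
Unset Printing Implicit Defensive.
Import Order.TTheory GRing.Theory Num.Theory.
Import numFieldNormedType.Exports.
Local Open Scope ring_scope.
Local Open Scope complex_scope.
Local Notation Re := complex.Re.
Local Notation Im := complex.Im.
Local Notation normc := Normc.normc.

(** * The finite triple product *)

Section FiniteTriple.
Variable K : fieldType.
Implicit Types x z p r : K.

Definition qpoch z p (n : nat) : K := \prod_(k < n) (1 - z * p ^+ k).

Lemma qpochS z p n : qpoch z p n.+1 = qpoch z p n * (1 - z * p ^+ n).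
Proof. by rewrite /qpoch big_ord_recr. Qed.

Lemma qpochSl z p n : qpoch z p n.+1 = (1 - z) * qpoch (z * p) p n.
Proof.
rewrite /qpoch big_ord_recl expr0 mulr1; congr (_ * _).
by apply: eq_bigr => i _; rewrite /bump /= exprS mulrA.
Qed.

Lemma qpoch0 z p : qpoch z p 0 = 1. Proof. by rewrite /qpoch big_ord0. Qed.

Lemma qpochD z p m n : qpoch z p (m + n) = qpoch z p m * qpoch (z * p ^+ m) p n.
Proof.
rewrite /qpoch big_split_ord /=; congr (_ * _).
by apply: eq_bigr => i _; rewrite exprD mulrA.
Qed.

(** The Gaussian binomial coefficient. The value 0 for [m < k] keeps the Pascal rule valid at the
    upper boundary. *)
Definition qbin p (m k : nat) : K :=
  if (k <= m)%N then qpoch p p m / (qpoch p p k * qpoch p p (m - k)) else 0.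

Lemma qbinS p m k : (forall n, qpoch p p n != 0) -> (k <= m)%N ->
  qbin p m.+1 k.+1 = qbin p m k.+1 + p ^+ (m - k) * qbin p m k.
Proof.
move=> p0 km; rewrite /qbin ltnS km subSS.
move: km; rewrite leq_eqVlt => /orP[/eqP <-|km].
  by rewrite ltnn subnn qpoch0 !mulr1 add0r expr0 mul1r !divff.
rewrite km -(subnSK km).
have /= := p0 (m - k)%N; rewrite -(subnSK km).
have := p0 k.+1; rewrite !qpochS -!exprS !mulf_eq0 !negb_or => /andP[? ?] /andP[? ?].
have -> : p ^+ m.+1 = p ^+ k.+1 * p ^+ (m - k.+1).+1.
  by rewrite -exprD; congr (_ ^+ _); lia.
by field; apply/and4P; split.
Qed.

Lemma qbin_n0 p m : (forall n, qpoch p p n != 0) -> qbin p m 0 = 1.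
Proof. by move=> p0; rewrite /qbin leq0n subn0 qpoch0 mul1r divff. Qed.

(** Induction on [m] through the Pascal rule. The base is a square so that its exponent k(k-1)/2
    becomes the exponent k(k-1) of [r], with no halving. *)
Lemma qbinomial_theorem r x m : (forall n, qpoch (r ^+ 2) (r ^+ 2) n != 0) ->
  qpoch x (r ^+ 2) m =
  \sum_(k < m.+1) (- x) ^+ k * r ^+ (k * k.-1) * qbin (r ^+ 2) m k.
Proof.
move=> p0; elim: m => [|m IH].
  by rewrite qpoch0 big_ord_recl big_ord0 qbin_n0 // !expr0 !mulr1 addr0.
pose t k := (- x) ^+ k * r ^+ (k * k.-1).
(* The Pascal factor turns the shifted term into [t k] times a constant free of [k], which is
   exactly what the new factor [1 - x * (r ^+ 2) ^+ m] contributes. *)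
have tS k : (k <= m)%N -> t k.+1 * (r ^+ 2) ^+ (m - k) = - (x * (r ^+ 2) ^+ m) * t k.
  move=> km; rewrite /t exprS -exprM -exprM.
  transitivity (- x * (- x) ^+ k * (r ^+ (k.+1 * k + 2 * (m - k)))).
    by rewrite exprD /=; ring.
  have -> : (k.+1 * k + 2 * (m - k) = 2 * m + k * k.-1)%N by case: k km => //=; nia.
  by rewrite exprD; ring.
rewrite qpochS IH [in RHS]big_ord_recl /= qbin_n0 //.
under [in RHS]eq_bigr => i _.
  rewrite /bump /= -/(t i.+1) qbinS ?p0 -1?ltnS // mulrDr mulrA tS -1?ltnS //.
  over.
rewrite big_split /=.
have -> : \sum_(i < m.+1) t i.+1 * qbin (r ^+ 2) m i.+1 =
  \sum_(k < m.+1) t k * qbin (r ^+ 2) m k - 1.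
  rewrite big_ord_recr /= [qbin _ m m.+1]/qbin ltnn mulr0 addr0.
  rewrite [in RHS]big_ord_recl /= qbin_n0 // /t !expr0 !mulr1 addrC addKr.
  by apply: eq_bigr => i _; rewrite /bump /=.
rewrite !expr0 !mulr1 addrA subrKC /t mulrBr mulr1; congr (_ + _).
rewrite -mulrN mulr_suml; apply: eq_bigr => i _; ring.
Qed.

Definition theta_term r z (j : int) : K := (- z) ^ j * r ^ (j * (j - 1)).

(** Each factor 1 - z r^(-2i), 1 <= i <= n, equals -z r^(-2i) (1 - r^(2i)/z). The monomials multiply
    to the prefactor because 2 + 4 + ... + 2n = n(n+1). *)
Lemma qpoch_rev r z n : r != 0 -> z != 0 ->
  qpoch (z / r ^+ (2 * n)) (r ^+ 2) n =
  (- z) ^+ n / r ^+ (n * n.+1) * qpoch (r ^+ 2 / z) (r ^+ 2) n.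
Proof.
move=> r0 z0; elim: n => [|n IH]; first by rewrite !qpoch0 mul0n !expr0 invr1 !mulr1.
rewrite qpochSl qpochS.
have -> : z / r ^+ (2 * n.+1) * r ^+ 2 = z / r ^+ (2 * n).
  by rewrite mulnS exprD; field; rewrite ?z0 ?r0 ?expf_neq0.
rewrite IH.
have -> : (n.+1 * n.+2 = n * n.+1 + 2 * n.+1)%N by nia.
have -> : r ^+ 2 / z * (r ^+ 2) ^+ n = r ^+ (2 * n.+1) / z.
  by rewrite mulnS exprD -exprM; ring.
rewrite [(- z) ^+ n.+1]exprS exprD.
by field; rewrite ?z0 ?r0 ?expf_neq0.
Qed.

(** This is the q-binomial theorem with 2n factors started at z / r^(2n): [qpoch_rev] turns the
    lower half of the product around, and recentring the index by n makes the sum symmetric about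
    0. *)
Lemma finite_jacobi_triple r z n : r != 0 -> z != 0 ->
  (forall n, qpoch (r ^+ 2) (r ^+ 2) n != 0) ->
  qpoch z (r ^+ 2) n * qpoch (r ^+ 2 / z) (r ^+ 2) n =
  \sum_(k < (2 * n).+1)
    theta_term r z (k%:Z - n%:Z) * qbin (r ^+ 2) (2 * n) k.
Proof.
move=> r0 z0 p0.
have zn0 : - z != 0 by rewrite oppr_eq0.
have c0 : (- z) ^+ n / r ^+ (n * n.+1) != 0.
  by rewrite mulf_neq0 ?invr_eq0 ?expf_neq0.
apply: (mulfI c0).
transitivity (qpoch (z / r ^+ (2 * n)) (r ^+ 2) (2 * n)).
  rewrite mul2n -addnn qpochD addnn -mul2n qpoch_rev // -exprM mulfVK ?expf_neq0 //.
  by ring.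
rewrite qbinomial_theorem // mulr_sumr; apply: eq_bigr => k _.
rewrite mulrA; congr (_ * _); rewrite /theta_term.
rewrite -mulNr !exprnP !invr_expz expfzMl exprz_exp.
rewrite mulrACA -!expfzDr // -mulrA -expfzDr //.
congr (_ ^ _ * _ ^ _); first by lia.
(* At 0 the truncated predecessor is 0 and not -1, hence the case split; its product with [k] is 0
   either way. *)
by case: (nat_of_ord k) => [|m] /=; nia.
Qed.
End FiniteTriple.

(** * Unconditional sums of complex families *)

Section ComplexLimits.
Variable R : realType.
Local Notation C := R[i].
Implicit Types (x y z : C) (e : R).

Lemma normr_normc x : `|x| = (normc x)%:C. Proof. by []. Qed.

Lemma normc_ge0 x : 0 <= normc x.
Proof. by rewrite -lecR -normr_normc normr_ge0. Qed.

Lemma normcX x n : normc (x ^+ n) = normc x ^+ n.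
Proof. by apply: complexI; rewrite rmorphXn -!normr_normc normrX. Qed.

Lemma normc_gt0 x : (0 < normc x) = (x != 0).
Proof. by rewrite -ltcR -normr_normc normr_gt0. Qed.

Lemma ler_normc_sum (T : Type) (s : seq T) (a : T -> C) :
  normc (\sum_(t <- s) a t) <= \sum_(t <- s) normc (a t).
Proof.
by rewrite -lecR -normr_normc rmorph_sum; apply: (le_trans (ler_norm_sum _ _ _)).
Qed.

Lemma ler_normc_norm x : normc x <= `|Re x| + `|Im x|.
Proof.
case: x => a b /=; rewrite -[leRHS]ger0_norm ?addr_ge0 // -sqrtr_sqr ler_sqrt ?sqr_ge0 //.
rewrite sqrrD !real_normK ?num_real //.
by rewrite addrAC lerDl mulrn_wge0 // mulr_ge0.
Qed.

Lemma normc_ltP x e : (`|x| < e%:C) = (normc x < e).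
Proof. by rewrite normr_normc ltcR. Qed.

(* [R[i]] gets its topology from its [numFieldType] structure. *)
Definition cplx : numFieldType := R[i].

Definition clim (u : nat -> C) (l : C) : Prop :=
  ((u : nat -> cplx) @ \oo --> (l : cplx))%classic.

(** A positive element of a complex field is real, so tolerances in C and tolerances in R define the
    same limits. *)
Lemma climP (u : nat -> C) (l : C) :
  clim u l <->
  forall e, 0 < e -> \forall n \near \oo%classic, normc (u n - l) < e.
Proof.
split=> [/cvgrPdist_lt ul e e0|ul].
  have := ul e%:C; rewrite ltcR => /(_ e0).
  by apply: filterS => n; rewrite distrC normc_ltP.
apply/cvgrPdist_lt => e e0.
have eE : e = (Re e)%:C by rewrite RRe_real // gtr0_real.
have := ul (Re e); rewrite -ltcR -eE => /(_ e0).
by apply: filterS => n; rewrite distrC eE normc_ltP.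
Qed.

Lemma clim_lim (u : nat -> C) (l : C) :
  clim u l -> lim ((u : nat -> cplx) @ \oo)%classic = l.
Proof. by apply: cvg_lim; exact: norm_hausdorff. Qed.

Lemma clim_uniq (u : nat -> C) (l m : C) : clim u l -> clim u m -> l = m.
Proof. by move=> /clim_lim <- /clim_lim. Qed.

Lemma clim_cst (l : C) : clim (fun=> l) l.
Proof. exact: cvg_cst. Qed.

Lemma climM (u v : nat -> C) (l m : C) :
  clim u l -> clim v m -> clim (fun n => u n * v n) (l * m).
Proof. exact: cvgM. Qed.

Lemma climV (u : nat -> C) (l : C) :
  l != 0 -> clim u l -> clim (fun n => (u n)^-1) l^-1.
Proof. exact: cvgV. Qed.

Lemma clim_near (u v : nat -> C) l :
  (\forall n \near \oo%classic, u n = v n) -> clim u l -> clim v l.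
Proof.
move=> uv /climP ul; apply/climP => e e0.
by apply: filterS2 uv (ul e e0) => n ->.
Qed.

Lemma clim_comp (u : nat -> C) (l : C) (f : nat -> nat) :
  (forall N, \forall n \near \oo%classic, (N <= f n)%N) ->
  clim u l -> clim (u \o f) l.
Proof.
move=> foo /climP ul; apply/climP => e /ul[N _ uN].
by apply: filterS (foo N) => n /uN.
Qed.

(** The telescoping series of increments converges absolutely by comparison with a geometric
    series. *)
Lemma real_geometric_cauchy (u : nat -> R) (c r : R) : 0 <= r < 1 ->
  (forall n, `|u n.+1 - u n| <= c * r ^+ n) -> cvgn u.
Proof.
move=> /andP[r0 r1] ur.
have c0 : 0 <= c by have := ur 0%N; rewrite expr0 mulr1; apply: le_trans.
have : cvgn (series (telescope u)).
  apply: normed_cvg; apply: (@series_le_cvg _ _ (geometric c r)) => [n|n|n|].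
  - exact: normr_ge0.
  - exact: geometric_ge0.
  - exact: ur.
  - by apply: is_cvg_geometric_series; rewrite ger0_norm.
move=> /cvg_ex[l ul]; apply/cvg_ex; exists (l + u 0%N).
apply: cvg_trans (cvgD ul (cvg_cst (u 0%N))); apply: near_eq_cvg.
by apply: nearW => n; rewrite [RHS]eq_sum_telescope addrC.
Qed.

(** Real and imaginary parts inherit the geometric bound, so completeness of [R] applies to each. *)
Lemma geometric_cauchy (u : nat -> C) (c r : R) : 0 <= r < 1 ->
  (forall n, normc (u n.+1 - u n) <= c * r ^+ n) ->
  exists l, clim u l.
Proof.
move=> r01 ur.
have le_Re x : `|Re x| <= normc x by rewrite -lecR -normr_normc normc_ge_Re.
have le_Im x : `|Im x| <= normc x.
  rewrite -normrN -ReiNIm; apply: le_trans (le_Re _) _.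
  by rewrite Normc.normcM /= expr0n expr1n add0r sqrtr1 mulr1.
have /cvg_ex[a ua] : cvgn (fun n => Re (u n)).
  apply: (real_geometric_cauchy (c := c) r01) => n.
  by apply: le_trans (ur n); rewrite -(raddfB (@Re R)) le_Re.
have /cvg_ex[b ub] : cvgn (fun n => Im (u n)).
  apply: (real_geometric_cauchy (c := c) r01) => n.
  by apply: le_trans (ur n); rewrite -(raddfB (@Im R)) le_Im.
exists (a +i* b); apply/climP => e e0.
have e20 : 0 < e / 2 by rewrite divr_gt0.
have /cvgrPdist_lt/(_ _ e20) ha := ua.
have /cvgrPdist_lt/(_ _ e20) hb := ub.
near=> n.
apply: (le_lt_trans (ler_normc_norm _)).
rewrite [e]splitr; apply: ltrD.
  rewrite (_ : Re _ = Re (u n) - a); last by case: (u n).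
  by rewrite distrC; near: n.
rewrite (_ : Im _ = Im (u n) - b); last by case: (u n).
by rewrite distrC; near: n.
Unshelve. all: by end_near.
Qed.

End ComplexLimits.

(** * Unconditional summation: tails, products, disjoint unions, dominated convergence *)

Section HasSum.
Variable R : realType.
Local Notation C := R[i].
Implicit Types (e : R).

(** Absolute summability; duplicate-free sequences play the role of finite subsets of [T]. *)
Definition abs_bounded (T : eqType) (a : T -> C) :=
  exists M : R, forall s, uniq s -> \sum_(t <- s) normc (a t) <= M.

(** The limit along finite subsets directed by inclusion. No enumeration of [T] is fixed, so double
    series can be regrouped along a bijection. *)
Definition has_sum (T : eqType) (a : T -> C) (x : C) :=
  forall e, 0 < e -> exists r : seq T, forall s, uniq s -> {subset r <= s} ->
    normc (\sum_(t <- s) a t - x) < e.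

Lemma big_subset_split (V : zmodType) (T : eqType) (f : T -> V) (r s : seq T) :
  uniq r -> uniq s -> {subset r <= s} ->
  \sum_(t <- s) f t = \sum_(t <- r) f t + \sum_(t <- s | t \notin r) f t.
Proof.
move=> ur us rs; rewrite (bigID (mem r)) /=; congr (_ + _).
rewrite -big_filter; apply: perm_big; apply: uniq_perm => //.
  exact: filter_uniq.
by move=> t; rewrite mem_filter; case: (boolP (t \in r)) => // /rs ->.
Qed.

(** Take [r] whose sum of moduli is within [e] of the supremum over all finite sets: whatever lies
    outside [r] can add less than [e]. *)
Lemma abs_bounded_tail (T : eqType) (a : T -> C) e : abs_bounded a -> 0 < e ->
  exists2 r, uniq r & forall s, uniq s ->
    \sum_(t <- s | t \notin r) normc (a t) < e.
Proof.
move=> [M aM] e0.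
pose E := [set x : R | exists2 s, uniq s & x = \sum_(t <- s) normc (a t)]%classic.
have supE : has_sup E.
  split; first by exists 0, [::]; rewrite ?big_nil.
  by exists M => _ [s us ->]; exact: aM.
have [_ [r ur ->] rE] := sup_adherent e0 supE.
exists r => // s us.
have uT : uniq (r ++ [seq t <- s | t \notin r]).
  rewrite cat_uniq ur filter_uniq // andbT /=; apply/hasPn => t.
  by rewrite mem_filter => /andP[].
have : E (\sum_(t <- r ++ [seq t <- s | t \notin r]) normc (a t)).
  by exists (r ++ [seq t <- s | t \notin r]).
move/(sup_upper_bound supE).
by rewrite big_cat big_filter /=; lra.
Qed.

Lemma has_sum_uniq (T : eqType) (a : T -> C) x y :
  has_sum a x -> has_sum a y -> x = y.
Proof.
move=> ax ay; apply/eqP; rewrite -subr_eq0 -normr_eq0 normr_normc.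
rewrite -[0]/(0%:C) (inj_eq (@complexI _)) eq_le normc_ge0 andbT leNgt.
apply/negP => d0; set d := normc _ in d0.
have d20 : 0 < d / 2 by rewrite divr_gt0.
have [r hr] := ax _ d20; have [s hs] := ay _ d20.
have u := undup_uniq (r ++ s).
have := hr _ u; have := hs _ u.
have sub1 : {subset r <= undup (r ++ s)} by move=> t; rewrite mem_undup mem_cat => ->.
have sub2 : {subset s <= undup (r ++ s)}.
  by move=> t; rewrite mem_undup mem_cat => ->; rewrite orbT.
move=> /(_ sub2) h2 /(_ sub1) h1.
set S := \sum_(t <- _) _ in h1 h2.
have := le_normcD (S - y) (- (S - x)); rewrite normcN.
rewrite (_ : S - y - (S - x) = x - y); last by ring.
by rewrite -/d; lra.
Qed.

Lemma eq_has_sum (T : eqType) (a b : T -> C) x :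
  a =1 b -> has_sum a x -> has_sum b x.
Proof.
move=> ab ax e e0; have [r hr] := ax e e0; exists r => s us rs.
by under eq_bigr do rewrite -ab; exact: hr.
Qed.

Lemma has_sumZ (T : eqType) (a : T -> C) k x :
  has_sum a x -> has_sum (fun t => k * a t) (k * x).
Proof.
move=> ax; have [->|k0] := eqVneq k 0.
  move=> e e0; exists [::] => s _ _; rewrite big1 => [|t _]; last by rewrite mul0r.
  by rewrite mul0r subr0 Normc.normc0.
have nk : 0 < normc k by rewrite normc_gt0.
move=> e e0; have [|r hr] := ax (e / normc k); first by rewrite divr_gt0.
exists r => s us rs; rewrite -mulr_sumr -mulrBr Normc.normcM mulrC -ltr_pdivlMr //.
exact: hr.
Qed.

(** Small tails make the net of finite sums Cauchy, so a cluster point is already its limit. Later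
    proofs thus need only one well-chosen finite set beyond each given one. *)
Lemma has_sum_cluster (T : eqType) (a : T -> C) x : abs_bounded a ->
  (forall (r : seq T) e, 0 < e -> exists s, [/\ uniq s, {subset r <= s} &
     normc (\sum_(t <- s) a t - x) < e]) ->
  has_sum a x.
Proof.
move=> ab cl e e0.
have e20 : 0 < e / 3 by rewrite divr_gt0.
have [r ur tl] := abs_bounded_tail ab e20.
have tl' s : uniq s -> {subset r <= s} ->
    normc (\sum_(t <- s) a t - \sum_(t <- r) a t) < e / 3.
  move=> us rs; rewrite (big_subset_split a ur us rs) addrC addKr -big_filter.
  by apply: le_lt_trans (ler_normc_sum _ _) _; rewrite big_filter; exact: tl.
have [s0 [us0 rs0 hs0]] := cl r _ e20.
exists r => s us rs.
have h1 := tl' _ us rs; have h2 := tl' _ us0 rs0.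
set A := \sum_(t <- s) _ in h1 *; set B := \sum_(t <- r) _ in h1 h2.
set D := \sum_(t <- s0) _ in h2 hs0.
have := le_normcD (A - B) (- (D - B)); have := le_normcD (A - B - (D - B)) (D - x).
rewrite normcN.
rewrite (_ : A - B - (D - B) + (D - x) = A - x); last by ring.
lra.
Qed.

Lemma sum_allpairs (V : pzSemiRingType) (T U : Type) (a : T -> V) (b : U -> V) r s :
  \sum_(p <- [seq (t, u) | t <- r, u <- s]) a p.1 * b p.2 =
  (\sum_(t <- r) a t) * (\sum_(u <- s) b u).
Proof.
rewrite big_allpairs /= mulr_suml; apply: eq_bigr => t _.
by rewrite mulr_sumr.
Qed.

(** Any finite set of pairs fits in a rectangle whose sides contain prescribed sets [r] and [s]; on
    rectangles a product family sums to a product. *)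
Lemma subset_allpairs (T U : eqType) (w : seq (T * U)) (r : seq T) (s : seq U) :
  {subset w <= [seq (t, u) | t <- undup (r ++ unzip1 w), u <- undup (s ++ unzip2 w)]}.
Proof.
move=> [t u] tu; apply/allpairsP; exists (t, u) => /=.
by rewrite !mem_undup !mem_cat; split => //; apply/orP; right; apply/mapP; exists (t, u).
Qed.

Lemma abs_boundedM (T U : eqType) (a : T -> C) (b : U -> C) :
  abs_bounded a -> abs_bounded b ->
  abs_bounded (fun p : T * U => a p.1 * b p.2).
Proof.
move=> [M aM] [N bN].
have M0 : 0 <= M by have := aM [::] isT; rewrite big_nil.
exists (M * N) => w uw.
set w' := [seq (t, u) | t <- undup ([::] ++ unzip1 w), u <- undup ([::] ++ unzip2 w)].
have uw' : uniq w' by apply: allpairs_uniq; rewrite ?undup_uniq // => -[? ?] [? ?].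
have le1 : \sum_(p <- w) normc (a p.1 * b p.2) <= \sum_(p <- w') normc (a p.1 * b p.2).
  rewrite (big_subset_split _ uw uw' (@subset_allpairs _ _ w [::] [::])).
  by rewrite lerDl sumr_ge0 // => p _; exact: normc_ge0.
apply: le_trans le1 _; under eq_bigr do rewrite Normc.normcM.
rewrite (sum_allpairs (fun t => normc (a t)) (fun u => normc (b u))).
by apply: ler_pM; rewrite ?aM ?bN ?undup_uniq ?sumr_ge0 // => *; exact: normc_ge0.
Qed.

Lemma has_sumM (T U : eqType) (a : T -> C) (b : U -> C) x y :
  abs_bounded a -> abs_bounded b -> has_sum a x -> has_sum b y ->
  has_sum (fun p : T * U => a p.1 * b p.2) (x * y).
Proof.
move=> ba bb ax bY; apply: has_sum_cluster; first exact: abs_boundedM.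
move=> w e e0.
(* With A and B within d <= 1 of x and y, the error of AB is at most d (1 + |x| + |y|). The constant
   2 instead of 1 makes the final bound strict. *)
pose d := Num.min 1 (e / (normc x + normc y + 2)).
have nx := normc_ge0 x; have ny := normc_ge0 y.
have K0 : 0 < normc x + normc y + 2 by lra.
have d0 : 0 < d by rewrite lt_min ltr01 divr_gt0.
have d1 : d <= 1 by rewrite ge_min lexx.
have dK : d * (normc x + normc y + 2) <= e.
  by rewrite -ler_pdivlMr // ge_min lexx orbT.
have [r hr] := ax _ d0; have [s hs] := bY _ d0.
exists [seq (t, u) | t <- undup (r ++ unzip1 w), u <- undup (s ++ unzip2 w)].
split.
- by apply: allpairs_uniq; rewrite ?undup_uniq // => -[? ?] [? ?].
- exact: subset_allpairs.
rewrite sum_allpairs.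
have {}hr := hr _ (undup_uniq (r ++ unzip1 w)).
have {}hs := hs _ (undup_uniq (s ++ unzip2 w)).
set A := \sum_(t <- _) _ in hr *; set B := \sum_(t <- _) _ in hs *.
have {}hr : normc (A - x) < d by apply: hr => t; rewrite mem_undup mem_cat => ->.
have {}hs : normc (B - y) < d by apply: hs => t; rewrite mem_undup mem_cat => ->.
have -> : A * B - x * y = (A - x) * (B - y) + (x * (B - y) + (A - x) * y) by ring.
apply: le_lt_trans (le_normcD _ _) _.
have := le_normcD (x * (B - y)) ((A - x) * y); rewrite !Normc.normcM.
have p0 := normc_ge0 (A - x); have q0 := normc_ge0 (B - y).
set p := normc (A - x) in hr p0 *; set q := normc (B - y) in hs q0 *.
have h1 : p * q <= d * 1 by apply: ler_pM => //; lra.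
have h2 : normc x * q <= normc x * d by apply: ler_wpM2l => //; lra.
have h3 : p * normc y <= d * normc y by apply: ler_wpM2r => //; lra.
by move=> h4; nra.
Qed.

(** A finite subset of [V] splits into its preimages in [T] and [U], and these contain [r] and [s]
    as soon as the subset contains their images. *)
Lemma has_sum_sum (T U V : eqType) (h : T + U -> V) (g : V -> T + U) (a : V -> C) x y :
  cancel h g -> cancel g h ->
  has_sum (a \o h \o inl) x -> has_sum (a \o h \o inr) y -> has_sum a (x + y).
Proof.
move=> hK gK ax ay e e0.
have e20 : 0 < e / 2 by rewrite divr_gt0.
have [r hr] := ax _ e20; have [s hs] := ay _ e20.
exists ([seq h (inl t) | t <- r] ++ [seq h (inr t) | t <- s]) => w uw sub.
pose gl v := if g v is inl t then Some t else None.
pose gr v := if g v is inr t then Some t else None.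
have glK : ocancel gl (h \o inl).
  by move=> v; rewrite /gl; case E : (g v) => //=; rewrite -E gK.
have grK : ocancel gr (h \o inr).
  by move=> v; rewrite /gr; case E : (g v) => //=; rewrite -E gK.
have -> : \sum_(v <- w) a v =
    \sum_(t <- pmap gl w) a (h (inl t)) + \sum_(t <- pmap gr w) a (h (inr t)).
  elim: w {uw sub} => [|v w IH]; first by rewrite !big_nil addr0.
  rewrite big_cons IH /=.
  have glE : gl v = if g v is inl t then Some t else None by [].
  have grE : gr v = if g v is inr t then Some t else None by [].
  rewrite {}glE {}grE.
  case E : (g v) => [t|t] /=.
    by rewrite big_cons -E gK addrA.
  by rewrite big_cons -E gK addrCA.
have h1 := hr _ (pmap_uniq glK uw); have h2 := hs _ (pmap_uniq grK uw).
have {}h1 := h1 _; have {}h2 := h2 _.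
rewrite opprD addrACA; apply: le_lt_trans (le_normcD _ _) _.
rewrite [e]splitr; apply: ltrD.
  apply: h1 => t tr; rewrite mem_pmap; apply/mapP; exists (h (inl t)).
    by apply: sub; rewrite mem_cat map_f.
  by rewrite /gl hK.
apply: h2 => t tr; rewrite mem_pmap; apply/mapP; exists (h (inr t)).
  by apply: sub; rewrite mem_cat [X in _ || X]map_f ?orbT.
by rewrite /gr hK.
Qed.

Lemma near_all (T : Type) (P : nat -> pred T) (s : seq T) :
  (forall t, \forall n \near \oo%classic, P n t) ->
  \forall n \near \oo%classic, all (P n) s.
Proof.
move=> nP; elim: s => [|t s IH]; first exact: nearW.
by near=> n; rewrite /= ; apply/andP; split; near: n.
Unshelve. all: by end_near.
Qed.

(** Dominated convergence used to identify a sum: if sums over [D n], with bounded weights tending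
    to 1, converge to [x], then the unweighted family sums to [x]. *)
Lemma tannery (T : eqType) (a : T -> C) (c : nat -> T -> C) (D : nat -> seq T)
    (M : R) (x : C) :
  abs_bounded a -> 0 <= M -> (forall n, uniq (D n)) ->
  (forall t, \forall n \near \oo%classic, t \in D n) ->
  (forall n t, normc (c n t) <= M) ->
  (forall t, clim (c^~ t) 1) ->
  clim (fun n => \sum_(t <- D n) c n t * a t) x ->
  has_sum a x.
Proof.
move=> ba M0 uD Dt cM c1 Fx; apply: has_sum_cluster => // w e e0.
(* The error has three parts: weights on [s] differing from 1, the tail outside [s], and the
   distance to the limit. Adding 1 to [M] and to [K] keeps the divisors positive. *)
have e30 : 0 < e / 3 by rewrite divr_gt0.
have d0 : 0 < e / 3 / (M + 1) by rewrite divr_gt0 //; lra.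
have [r ur tl] := abs_bounded_tail ba d0.
set s := undup (w ++ r); have us : uniq s by exact: undup_uniq.
set K := \sum_(t <- s) normc (a t).
have K0 : 0 <= K by apply: sumr_ge0 => *; exact: normc_ge0.
have d'0 : 0 < e / 3 / (K + 1) by rewrite divr_gt0 //; lra.
have /climP/(_ _ e30) Fx' := Fx.
have nD : \forall n \near \oo%classic, all (mem (D n)) s by exact: near_all.
have nc : \forall n \near \oo%classic,
    all (fun t => normc (c n t - 1) < e / 3 / (K + 1)) s.
  by apply: near_all => t; have /climP/(_ _ d'0) := c1 t.
(* A single large [n] meets all three requirements at once. *)
have [n [[sD cs] Fn]] := filter_ex (filterI (filterI nD nc) Fx').
exists s; split=> // [t tw|]; first by rewrite mem_undup mem_cat tw.
have {}sD : {subset s <= D n} by move=> t; exact: (allP sD).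
rewrite (big_subset_split _ us (uD n) sD) in Fn.
set A := \sum_(t <- s) c n t * a t in Fn; set B := \sum_(t <- D n | _) _ in Fn.
have hB : normc B < e / 3.
  rewrite /B -big_filter; apply: le_lt_trans (ler_normc_sum _ _) _; rewrite big_filter.
  apply: (@le_lt_trans _ _ (\sum_(t <- D n | t \notin r) M * normc (a t))).
    apply: (@le_trans _ _ (\sum_(t <- D n | t \notin s) M * normc (a t))).
      by apply: ler_sum => t _; rewrite Normc.normcM ler_wpM2r ?normc_ge0.
    rewrite [leRHS]big_mkcond [leLHS]big_mkcond; apply: ler_sum => t _.
    rewrite mem_undup mem_cat negb_or; case: (t \notin r); rewrite ?andbT ?andbF //.
    by case: ifP; rewrite ?mulr_ge0 ?normc_ge0.
  rewrite -mulr_sumr; apply: le_lt_trans (_ : _ <= (M + 1) * _) _.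
    apply: ler_wpM2r; last by lra.
    by apply: sumr_ge0 => *; exact: normc_ge0.
  rewrite mulrC -ltr_pdivlMr; last by lra.
  exact: tl.
set S := \sum_(t <- s) a t.
have hA : normc (A - S) < e / 3.
  have -> : A - S = \sum_(t <- s) (c n t - 1) * a t.
    by rewrite -sumrB; apply: eq_bigr => t _; rewrite mulrBl mul1r.
  apply: le_lt_trans (ler_normc_sum _ _) _.
  apply: (@le_lt_trans _ _ (e / 3 / (K + 1) * K)).
    rewrite mulr_sumr big_seq [leRHS]big_seq; apply: ler_sum => t ts.
    by rewrite Normc.normcM ler_wpM2r ?normc_ge0 // ltW // (allP cs).
  by rewrite mulrAC ltr_pdivrMr; [nra|lra].
have -> : S - x = - (A - S) + (A + B - x) + - B by ring.
apply: le_lt_trans (le_normcD _ _) _; have := le_normcD (- (A - S)) (A + B - x).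
rewrite !normcN; lra.
Qed.
End HasSum.

(** * Jacobi's triple product *)

Section TripleProduct.
Variable R : realType.
Local Notation C := R[i].
Implicit Types (e : R) (z p : C).

(** From 1 + x <= exp x. The induction carries the exact partial geometric sum in the exponent,
    which is bounded by the full sum only at the end. *)
Lemma prod1D_geometric_le (c r : R) n : 0 <= c -> 0 <= r < 1 ->
  \prod_(k < n) (1 + c * r ^+ k) <= expR (c / (1 - r)).
Proof.
move=> c0 /andP[r0 r1].
have r10 : 1 - r != 0 by rewrite subr_eq0 gt_eqF.
have H : \prod_(k < n) (1 + c * r ^+ k) <= expR (c * ((1 - r ^+ n) / (1 - r))).
  elim: n => [|n IH]; first by rewrite big_ord0 expr0 subrr mul0r mulr0 expR0.
  rewrite big_ord_recr /=.
  have -> : c * ((1 - r ^+ n.+1) / (1 - r)) =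
      c * ((1 - r ^+ n) / (1 - r)) + c * r ^+ n.
    by rewrite exprS; field.
  rewrite expRD; apply: ler_pM => //; last exact: expR_ge1Dx.
    by apply: prodr_ge0 => k _; rewrite addr_ge0 // mulr_ge0 ?exprn_ge0.
  by rewrite addr_ge0 // mulr_ge0 ?exprn_ge0.
apply: le_trans H _; rewrite ler_expR ler_wpM2l //.
rewrite ler_pdivrMr ?subr_gt0 // mulVf // gerBl.
exact: exprn_ge0.
Qed.

Lemma qpoch_real_lower (r : R) : 0 <= r < 1 ->
  exists2 d : R, 0 < d & forall n, d <= qpoch r r n <= 1.
Proof.
move=> /andP[r0 r1].
have r10 : 0 < 1 - r by rewrite subr_gt0.
(* This [c] makes 1 + c r^k at least the inverse of 1 - r^(k+1), so an upper bound on the product of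
   the former gives a lower bound on the product of the latter. *)
pose c := r / (1 - r); have c0 : 0 <= c by rewrite divr_ge0 // ltW.
exists (expR (c / (1 - r)))^-1; first by rewrite invr_gt0 expR_gt0.
move=> n.
have f01 (k : nat) : 0 <= 1 - r * r ^+ k <= 1.
  rewrite -exprS subr_ge0 gerBl exprn_ge0 // andbT.
  by apply: exprn_ile1 => //; exact: ltW.
apply/andP; split; last first.
  rewrite /qpoch -[leRHS](_ : \prod_(k < n) (1 : R) = 1); last by rewrite big1.
  by apply: ler_prod.
rewrite -[leLHS]mul1r ler_pdivrMr ?expR_gt0 //.
apply: (@le_trans _ _ (qpoch r r n * \prod_(k < n) (1 + c * r ^+ k))); last first.
  apply: ler_wpM2l; last by apply: prod1D_geometric_le => //; rewrite r0.
  by apply: prodr_ge0 => k _; case/andP: (f01 k).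
rewrite /qpoch -big_split /= -[leLHS](_ : \prod_(k < n) (1 : R) = 1); last by rewrite big1.
apply: ler_prod => k _; rewrite ler01 /=.
have s0 : 0 <= r ^+ k by exact: exprn_ge0.
have s1 : r ^+ k <= 1 by apply: exprn_ile1 => //; exact: ltW.
have -> : (1 - r * r ^+ k) * (1 + c * r ^+ k) = 1 + c * r ^+ k * (r * (1 - r ^+ k)).
  by rewrite /c; field; rewrite gt_eqF.
by rewrite lerDl; apply: mulr_ge0; rewrite mulr_ge0 ?subr_ge0.
Qed.

Lemma normc_1B z : normc (1 - z) <= 1 + normc z.
Proof. by have := le_normcD 1 (- z); rewrite normcN Normc.normc1. Qed.

Lemma normc_1B_ge z : 1 - normc z <= normc (1 - z).
Proof.
have := le_normcD (1 - z) z; rewrite subrK Normc.normc1; lra.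
Qed.

Lemma normc_prod (I : Type) (s : seq I) (F : I -> C) :
  normc (\prod_(i <- s) F i) = \prod_(i <- s) normc (F i).
Proof. by apply: complexI; rewrite rmorph_prod -normr_normc normr_prod. Qed.

Lemma normc_qpoch_le z p n : normc p < 1 ->
  normc (qpoch z p n) <= expR (normc z / (1 - normc p)).
Proof.
move=> p1; rewrite normc_prod.
apply: le_trans (prod1D_geometric_le n (normc_ge0 z) _); last by rewrite normc_ge0.
apply: ler_prod => k _; rewrite normc_ge0 /=.
by apply: le_trans (normc_1B _) _; rewrite Normc.normcM normcX.
Qed.

(** Compare factorwise with the real product at |p|. Uniformity in [n] gives both a nonzero infinite
    product and bounded Gaussian binomials. *)
Lemma qpoch_lower p : normc p < 1 ->
  exists2 d : R, 0 < d & forall n, d <= normc (qpoch p p n).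
Proof.
move=> p1; have p01 : 0 <= normc p < 1 by rewrite normc_ge0.
have [d d0 hd] := qpoch_real_lower p01; exists d => // n.
have /andP[+ _] := hd n; move/le_trans; apply.
rewrite normc_prod; apply: ler_prod => k _.
rewrite -exprS subr_ge0 exprn_ile1 ?normc_ge0 ?(ltW p1) //=.
by apply: le_trans (normc_1B_ge _); rewrite -exprS normcX.
Qed.

Lemma qpoch_neq0 p n : normc p < 1 -> qpoch p p n != 0.
Proof.
move=> p1; have [d d0 hd] := qpoch_lower p1.
by rewrite -normc_gt0 (lt_le_trans d0).
Qed.

Definition qpinf z p : C := lim ((qpoch z p : nat -> cplx R) @ \oo)%classic.

Lemma clim_qpoch z p : normc p < 1 -> clim (qpoch z p) (qpinf z p).
Proof.
move=> p1.
have [||l hl] := @geometric_cauchy _ (qpoch z p)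
    (expR (normc z / (1 - normc p)) * normc z) (normc p).
- by rewrite normc_ge0.
- move=> n; rewrite qpochS.
  have -> : qpoch z p n * (1 - z * p ^+ n) - qpoch z p n =
      - (qpoch z p n * z * p ^+ n) by ring.
  rewrite normcN !Normc.normcM normcX.
  apply: ler_wpM2r; first by rewrite exprn_ge0 // normc_ge0.
  by apply: ler_wpM2r; [exact: normc_ge0 | exact: normc_qpoch_le].
by rewrite /qpinf (clim_lim hl).
Qed.

Lemma qpinf_neq0 p : normc p < 1 -> qpinf p p != 0.
Proof.
move=> p1; have [d d0 hd] := qpoch_lower p1; apply/eqP => l0.
have /climP/(_ _ d0) := @clim_qpoch p p p1; rewrite l0 => /filter_ex[n].
by rewrite subr0 ltNge hd.
Qed.

Definition int_range (n : nat) : seq int :=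
  [seq k%:Z - n%:Z | k <- iota 0 (2 * n).+1].

Lemma int_range_uniq n : uniq (int_range n).
Proof. by rewrite map_inj_uniq ?iota_uniq // => i j /addIr []. Qed.

Lemma mem_int_range n j : (j \in int_range n) = (absz j <= n)%N.
Proof.
apply/mapP/idP => [[k + ->]|jn]; first by rewrite mem_iota; lia.
by exists (absz (j + n%:Z)); rewrite ?mem_iota; lia.
Qed.

Lemma big_int_range (V : nmodType) (F : int -> V) n :
  \sum_(j <- int_range n) F j = \sum_(k < (2 * n).+1) F (k%:Z - n%:Z).
Proof. by rewrite big_map -[iota _ _]/(index_iota 0 (2 * n).+1) big_mkord. Qed.

Lemma normc_expz z (j : int) : normc (z ^ j) = normc z ^ j.
Proof.
case: j => n; first exact: normcX.
by rewrite -[z ^ _]/(z ^- n.+1) -[RHS]/(normc z ^- n.+1) Normc.normcV normcX.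
Qed.

(** The argument is [- normc z] because [theta_term] negates it; the moduli are again theta terms,
    so the finite triple product can bound their sums. *)
Lemma normc_theta_term p z j :
  normc (theta_term p z j) = theta_term (normc p) (- normc z) j.
Proof. by rewrite /theta_term Normc.normcM !normc_expz normcN opprK. Qed.

(** Apply the finite triple product at |p| and -|z|, where all terms are nonnegative. Each Gaussian
    binomial is at least [d], its denominator being at most 1, and the product side is bounded by
    exponentials. *)
Lemma abs_bounded_theta p z : p != 0 -> z != 0 -> normc p < 1 ->
  abs_bounded (theta_term p z).
Proof.
move=> p0 z0 p1; set r := normc p; set t := normc z.
have r0 : 0 < r by rewrite normc_gt0.
have t0 : 0 < t by rewrite normc_gt0.
have r2 : 0 <= r ^+ 2 < 1 by rewrite exprn_ge0 ?expr_lt1 // ltW.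
have [d d0 hd] := qpoch_real_lower r2.
have P0 n : 0 < qpoch (r ^+ 2) (r ^+ 2) n by case/andP: (hd n) => /(lt_le_trans d0).
have tt0 j : 0 <= theta_term r (- t) j.
  by rewrite /theta_term opprK mulr_ge0 // exprz_ge0 // ltW.
have neg (c : R) n : 0 <= c ->
    qpoch (- c) (r ^+ 2) n <= expR (c / (1 - r ^+ 2)).
  move=> c0; apply: le_trans (prod1D_geometric_le n c0 r2).
  by rewrite /qpoch; under eq_bigr do rewrite mulNr opprK.
have neg0 (c : R) n : 0 <= c -> 0 <= qpoch (- c) (r ^+ 2) n.
  move=> c0; apply: prodr_ge0 => k _; rewrite mulNr opprK addr_ge0 // mulr_ge0 //.
  by rewrite !exprn_ge0 // ltW.
pose E1 := expR (t / (1 - r ^+ 2)); pose E2 := expR (r ^+ 2 / t / (1 - r ^+ 2)).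
have sumE n : \sum_(j <- int_range n) theta_term r (- t) j <= E1 * E2 / d.
  rewrite ler_pdivlMr // mulr_suml big_int_range.
  apply: (@le_trans _ _ (qpoch (- t) (r ^+ 2) n * qpoch (r ^+ 2 / - t) (r ^+ 2) n)).
    rewrite finite_jacobi_triple ?oppr_eq0 ?(lt0r_neq0 r0) ?(lt0r_neq0 t0) //; last first.
      by move=> m; exact: lt0r_neq0.
    apply: ler_sum => k _; apply: ler_wpM2l => //.
    rewrite /qbin -ltnS ltn_ord ler_pdivlMr ?mulr_gt0 //.
    case/andP: (hd (2 * n)%N) => h _; apply: le_trans h.
    rewrite ger_pMr //; case/andP: (hd k) => _ h1; case/andP: (hd (2 * n - k)%N) => _ h2.
    by rewrite mulr_ile1 // ltW.
  have -> : r ^+ 2 / - t = - (r ^+ 2 / t) by rewrite invrN mulrN.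
  have c0 : 0 <= r ^+ 2 / t by rewrite divr_ge0 ?exprn_ge0 // ltW.
  by apply: ler_pM; rewrite ?neg ?neg0 // ltW.
exists (E1 * E2 / d) => s us; under eq_bigr do rewrite normc_theta_term.
pose n := \max_(j <- s) absz j.
apply: le_trans (sumE n).
have sub : {subset s <= int_range n}.
  by move=> j js; rewrite mem_int_range /n; exact: leq_bigmax_seq.
rewrite (big_subset_split _ us (int_range_uniq n) sub) lerDl.
by apply: sumr_ge0 => j _; exact: tt0.
Qed.

(** The parameter is the square root of the base, matching [theta_term]; the function j with base
    q^6 is [jtheta (q ^+ 3)]. *)
Definition jtheta p z : C :=
  qpinf (p ^+ 2) (p ^+ 2) * (qpinf z (p ^+ 2) * qpinf (p ^+ 2 / z) (p ^+ 2)).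

Theorem jacobi_triple p z : p != 0 -> z != 0 -> normc p < 1 ->
  has_sum (theta_term p z) (jtheta p z).
Proof.
move=> p0 z0 p1.
have p21 : normc (p ^+ 2) < 1 by rewrite normcX expr_lt1 // normc_ge0.
set P := qpinf (p ^+ 2) (p ^+ 2).
have P0 : P != 0 by exact: qpinf_neq0.
have Pn0 n : qpoch (p ^+ 2) (p ^+ 2) n != 0 by exact: qpoch_neq0.
have cP : clim (qpoch (p ^+ 2) (p ^+ 2)) P by exact: clim_qpoch.
have [d d0 hd] := qpoch_lower p21.
pose E := expR (normc (p ^+ 2) / (1 - normc (p ^+ 2))).
(* For fixed [j] the Gaussian binomial tends to P / (P P), so the factor [P] normalizes the weights
   to limit 1. On [int_range n] the number [j + n] is nonnegative and the absolute value changes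
   nothing. *)
pose c n (j : int) := P * qbin (p ^+ 2) (2 * n) (absz (j + n%:Z)).
apply: (@tannery _ _ _ c int_range (normc P * (E / (d * d)))).
- exact: abs_bounded_theta.
- by rewrite mulr_ge0 ?normc_ge0 // divr_ge0 ?expR_ge0 // ltW // mulr_gt0.
- exact: int_range_uniq.
- by move=> j; exists (absz j) => // n /=; rewrite mem_int_range.
- move=> n j; rewrite /c Normc.normcM ler_wpM2l ?normc_ge0 // /qbin.
  have M0 : 0 <= E / (d * d) by rewrite divr_ge0 ?expR_ge0 // ltW // mulr_gt0.
  case: ifP => _; last by rewrite Normc.normc0.
  rewrite Normc.normcM Normc.normcV; apply: ler_pM; rewrite ?normc_ge0 ?invr_ge0 ?normc_ge0 //.
    exact: normc_qpoch_le.
  rewrite lef_pV2 ?posrE ?mulr_gt0 //; last by rewrite normc_gt0 mulf_neq0.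
  by rewrite Normc.normcM ler_pM // ltW.
- move=> j.
  have ev : \forall n \near \oo%classic, P * (qpoch (p ^+ 2) (p ^+ 2) (2 * n) *
      ((qpoch (p ^+ 2) (p ^+ 2) (absz (j + n%:Z)))^-1 *
       (qpoch (p ^+ 2) (p ^+ 2) (2 * n - absz (j + n%:Z)%R)%N)^-1)) = c n j.
    exists (absz j) => // n /= jn; rewrite /c /qbin.
    by rewrite ifT ?invfM //; lia.
  apply: clim_near ev _.
  have -> : (1 : C) = P * (P * (P^-1 * P^-1)) by field.
  apply: climM; first exact: clim_cst.
  apply: climM.
    apply: (clim_comp (f := fun n => (2 * n)%N)) cP => N.
    by exists N => // n /=; lia.
  apply: climM; apply: climV => //.
    apply: (clim_comp (f := fun n => absz (j + n%:Z))) cP => N.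
    by exists (N + `|j|)%N => // n /=; lia.
  apply: (clim_comp (f := fun n => (2 * n - absz (j + n%:Z)%R)%N)) cP => N.
  by exists (N + `|j|)%N => // n /=; lia.
have ev : \forall n \near \oo%classic,
    P * (qpoch z (p ^+ 2) n * qpoch (p ^+ 2 / z) (p ^+ 2) n) =
    \sum_(j <- int_range n) c n j * theta_term p z j.
  apply: nearW => n; rewrite finite_jacobi_triple // big_int_range mulr_sumr.
  apply: eq_bigr => k _; rewrite /c subrK absz_nat; ring.
apply: clim_near ev _; apply: climM; first exact: clim_cst.
by apply: climM; apply: clim_qpoch.
Qed.

End TripleProduct.

(** * Weierstrass' three-term relation *)

Section ThetaAlgebra.
Variable K : fieldType.
Implicit Types a p x y z u v : K.

Lemma divf_mul_self a z : a != 0 -> z != 0 -> a / (a * z) = z^-1.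
Proof. by move=> a0 z0; field; rewrite z0. Qed.

Lemma divf_div_self a z : a != 0 -> z != 0 -> a / (a / z) = z.
Proof. by move=> a0 z0; field; rewrite z0. Qed.

Lemma theta_shift_identity P A B z : z != 0 ->
  P * (A * ((1 - z^-1) * B)) = - z^-1 * (P * ((1 - z) * A * B)).
Proof. by move=> z0; field. Qed.

Lemma theta_termM p x y m n : p != 0 -> x != 0 -> y != 0 ->
  theta_term p (x * y) m * theta_term p (x / y) n =
  (-1) ^ (m + n) * x ^ (m + n) * y ^ (m - n) * p ^ (m * (m - 1) + n * (n - 1)).
Proof.
move=> p0 x0 y0; rewrite /theta_term -[- (x * y)]mulN1r -[- (x / y)]mulN1r.
rewrite !expfzMl exprz_inv !(expfzDr _ _ p0) !(expfzDr _ _ x0) !(expfzDr _ _ y0).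
by rewrite !expfzDr ?oppr_eq0 ?oner_eq0 //; ring.
Qed.

Lemma theta_term_sqr p x m :
  theta_term (p ^+ 2) (- x ^+ 2) m = x ^ (2 * m) * p ^ (2 * (m * (m - 1))).
Proof. by rewrite /theta_term opprK !exprnP !exprz_exp. Qed.

Lemma expN1_double (s : int) : (-1 : K) ^ (2 * s) = 1.
Proof. by rewrite -exprz_exp -exprnP sqrrN expr1n exp1rz. Qed.

(** With m = s + d and n = s - d, m(m-1) + n(n-1) = 2s(s-1) + 2d + 2d(d-1) has no cross term, so the
    variables [s], [x] separate from [d], [y]. *)
Lemma theta_termM_even p x y (s d : int) : p != 0 -> x != 0 -> y != 0 ->
  theta_term (p ^+ 2) (- x ^+ 2) s * theta_term (p ^+ 2) (- (p ^+ 2 * y ^+ 2)) d =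
  theta_term p (x * y) (s + d) * theta_term p (x / y) (s - d).
Proof.
move=> p0 x0 y0; rewrite theta_termM // -exprMn !theta_term_sqr.
have -> : s + d + (s - d) = 2 * s by ring.
have -> : s + d - (s - d) = 2 * d by ring.
have -> : (s + d) * (s + d - 1) + (s - d) * (s - d - 1) =
  2 * (s * (s - 1)) + 2 * d + 2 * (d * (d - 1)) by ring.
by rewrite expN1_double expfzMl !(expfzDr _ _ p0); ring.
Qed.

(** The same separation for odd m + n. The argument [(p ^+ 2) ^+ 2 * - y ^+ 2] is left in the shape
    to which [jtheta_shift] applies. *)
Lemma theta_termM_odd p x y (s d : int) : p != 0 -> x != 0 -> y != 0 ->
  - (x * y) * (theta_term (p ^+ 2) (- (p ^+ 2 * x ^+ 2)) s *
               theta_term (p ^+ 2) ((p ^+ 2) ^+ 2 * - y ^+ 2) d) =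
  theta_term p (x * y) (s + d + 1) * theta_term p (x / y) (s - d).
Proof.
move=> p0 x0 y0; rewrite theta_termM //.
have -> : (p ^+ 2) ^+ 2 * - y ^+ 2 = - (p ^+ 2 * y) ^+ 2 by ring.
rewrite -exprMn !theta_term_sqr.
have -> : s + d + 1 + (s - d) = 2 * s + 1 by ring.
have -> : s + d + 1 - (s - d) = 2 * d + 1 by ring.
rewrite [(-1) ^ _]expfzDr ?oppr_eq0 ?oner_eq0 // expN1_double mul1r expr1z.
rewrite !expfzMl [x ^ (_ + 1)]expfzDr // [y ^ (_ + 1)]expfzDr // !expr1z.
have -> : (s + d + 1) * (s + d + 1 - 1) + (s - d) * (s - d - 1) =
    2 * s + 2 * (s * (s - 1)) + 2 * d + 2 * d + 2 * (d * (d - 1)) by ring.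
by rewrite !(expfzDr _ _ p0); ring.
Qed.

Lemma theta_odd_identity x y A B : y != 0 ->
  - (x / y * (A * B)) = - (x * y) * (A * (- (- y ^+ 2)^-1 * B)).
Proof. by move=> y0; field; rewrite ?oppr_eq0 ?expf_eq0 ?y0 ?oner_eq0 ?(negPf y0). Qed.

(** Here y Txy is the determinant of the vectors (Ex, x Ox) and (Ey, y Oy), and likewise for the
    other pairs; four vectors in the plane satisfy the Pluecker relation. *)
Lemma plucker_identity x y u v Ex Ox Ey Oy Eu Ou Ev Ov Txy Tuv Txv Tuy Tyv Txu :
  y != 0 -> u != 0 -> v != 0 ->
  Txy = Ex * Oy - x / y * (Ox * Ey) -> Tuv = Eu * Ov - u / v * (Ou * Ev) ->
  Txv = Ex * Ov - x / v * (Ox * Ev) -> Tuy = Eu * Oy - u / y * (Ou * Ey) ->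
  Tyv = Ey * Ov - y / v * (Oy * Ev) -> Txu = Ex * Ou - x / u * (Ox * Eu) ->
  Txy * Tuv - Txv * Tuy = u / y * (Tyv * Txu).
Proof. by move=> y0 u0 v0 -> -> -> -> -> ->; field; rewrite y0 u0 v0. Qed.

Lemma qpoch_dissect z p m n :
  qpoch z p (m * n) = \prod_(i < m) qpoch (z * p ^+ i) (p ^+ m) n.
Proof.
elim: n => [|n IH]; first by rewrite muln0 qpoch0 big1 // => i _; rewrite qpoch0.
rewrite mulnS addnC qpochD IH [qpoch _ p m]/qpoch -big_split /=.
by apply: eq_bigr => i _; rewrite qpochS -exprM; congr (_ * (1 - _)); ring.
Qed.

Lemma qpochN z p n : qpoch (z ^+ 2) (p ^+ 2) n = qpoch z p n * qpoch (- z) p n.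
Proof.
rewrite /qpoch -big_split /=.
by apply: eq_bigr => i _; rewrite -exprM mulnC exprM; ring.
Qed.

End ThetaAlgebra.

(** * Functional equations, product formula and three-term relation of the theta function *)

Section ThetaRelations.
Variable R : realType.
Local Notation C := R[i].
Implicit Types p q x y z u v : C.

Lemma normcX_lt1 p n : (0 < n)%N -> normc p < 1 -> normc (p ^+ n) < 1.
Proof. by move=> n0 p1; rewrite normcX exprn_ilt1 // ?normc_ge0 -?lt0n. Qed.

Lemma qpinf_rec z p : normc p < 1 -> qpinf z p = (1 - z) * qpinf (p * z) p.
Proof.
move=> p1; apply: (@clim_uniq _ (fun n => qpoch z p n.+1)).
  have h : clim (qpoch z p \o S) (qpinf z p).
    by apply: clim_comp (@clim_qpoch _ z p p1) => N; exists N => // n /=; exact: leqW.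
  exact: h.
have h := climM (@clim_cst _ (1 - z)) (@clim_qpoch _ (p * z) p p1).
by apply: clim_near h; apply: nearW => n; rewrite qpochSl [p * z]mulrC.
Qed.

(** The shift removes the factor 1 - z from one product and adds 1 - 1/z to the other; their ratio
    is -1/z. *)
Lemma jtheta_shift p z : p != 0 -> z != 0 -> normc p < 1 ->
  jtheta p (p ^+ 2 * z) = - z^-1 * jtheta p z.
Proof.
move=> p0 z0 p1; have p21 : normc (p ^+ 2) < 1 := @normcX_lt1 p 2 isT p1.
have q0 : p ^+ 2 != 0 := expf_neq0 2 p0.
rewrite /jtheta (divf_mul_self q0 z0) (qpinf_rec z^-1 p21) (qpinf_rec z p21).
exact: theta_shift_identity.
Qed.

Lemma jthetaV p z : p != 0 -> z != 0 -> normc p < 1 ->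
  jtheta p z^-1 = - z^-1 * jtheta p z.
Proof.
move=> p0 z0 p1; rewrite -(jtheta_shift p0 z0 p1) /jtheta.
rewrite (divf_mul_self (expf_neq0 2 p0) z0) invrK; congr (_ * _); exact: mulrC.
Qed.

Lemma jthetaC p z : p != 0 -> z != 0 -> jtheta p (p ^+ 2 / z) = jtheta p z.
Proof.
move=> p0 z0; rewrite /jtheta (divf_div_self (expf_neq0 2 p0) z0); congr (_ * _).
exact: mulrC.
Qed.

Definition parity_pair (w : int * int + int * int) : int * int :=
  match w with
  | inl (s, d) => (s + d, s - d)
  | inr (s, d) => (s + d + 1, s - d)
  end.

(** Integer division rounds down, so in the odd case 2s + 1 and 2d + 1 still give back [s] and
    [d]. *)
Definition parity_split (mn : int * int) : int * int + int * int :=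
  let: (m, n) := mn in
  if ((m + n) %% 2)%Z == 0 then inl (((m + n) %/ 2)%Z, ((m - n) %/ 2)%Z)
  else inr (((m + n) %/ 2)%Z, ((m - n) %/ 2)%Z).

Lemma parity_pairK : cancel parity_pair parity_split.
Proof.
move=> [[s d]|[s d]] /=; [rewrite ifT; last lia|rewrite ifF; last lia].
  by congr (inl (_, _)); lia.
by congr (inr (_, _)); lia.
Qed.

Lemma parity_splitK : cancel parity_split parity_pair.
Proof.
move=> [m n] /=; case: ifP => h /=; congr (_, _); lia.
Qed.

(** Both sides are sums of the same double series: once as a product of two triple-product series,
    once regrouped by the parity of m + n. *)
Lemma jtheta_mul p x y : p != 0 -> x != 0 -> y != 0 -> normc p < 1 ->
  jtheta p (x * y) * jtheta p (x / y) =
  jtheta (p ^+ 2) (- x ^+ 2) * jtheta (p ^+ 2) (- (p ^+ 2 * y ^+ 2)) -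
  x / y * (jtheta (p ^+ 2) (- (p ^+ 2 * x ^+ 2)) * jtheta (p ^+ 2) (- y ^+ 2)).
Proof.
move=> p0 x0 y0 p1; have p21 : normc (p ^+ 2) < 1 := @normcX_lt1 p 2 isT p1.
have q0 : p ^+ 2 != 0 := expf_neq0 2 p0.
have neg z : z != 0 -> - z != 0 by rewrite oppr_eq0.
have xx0 := neg _ (expf_neq0 2 x0); have yy0 := neg _ (expf_neq0 2 y0).
have px0 := neg _ (mulf_neq0 q0 (expf_neq0 2 x0)).
have py0 := neg _ (mulf_neq0 q0 (expf_neq0 2 y0)).
have ppy0 := mulf_neq0 (expf_neq0 2 q0) yy0.
have xy0 := mulf_neq0 x0 y0; have xVy0 := mulf_neq0 x0 (invr_neq0 y0).
have prod p' z w : p' != 0 -> z != 0 -> w != 0 -> normc p' < 1 ->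
    has_sum (fun mn => theta_term p' z mn.1 * theta_term p' w mn.2)
      (jtheta p' z * jtheta p' w).
  move=> p'0 z0 w0 p'1; apply: has_sumM.
  - exact: (abs_bounded_theta p'0 z0 p'1).
  - exact: (abs_bounded_theta p'0 w0 p'1).
  - exact: (jacobi_triple p'0 z0 p'1).
  - exact: (jacobi_triple p'0 w0 p'1).
apply: (has_sum_uniq (prod _ _ _ p0 xy0 xVy0 p1)).
(* The subtracted product is rewritten as the sum of the odd part, with its second argument shifted
   by one period. *)
rewrite (theta_odd_identity _ _ _ y0) -(jtheta_shift q0 yy0 p21).
apply: (has_sum_sum parity_pairK parity_splitK).
  by apply: eq_has_sum (prod _ _ _ q0 xx0 py0 p21) => -[s d]; exact: theta_termM_even.
apply: eq_has_sum (has_sumZ _ (prod _ _ _ q0 px0 ppy0 p21)) => -[s d].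
exact: theta_termM_odd.
Qed.

(* The right-hand side of [jtheta_mul] is a 2x2 determinant in the vectors
   attached to x and y, so this is a Pluecker relation. *)
Lemma weierstrass_relation p x y u v :
  p != 0 -> x != 0 -> y != 0 -> u != 0 -> v != 0 -> normc p < 1 ->
  jtheta p (x * y) * jtheta p (x / y) * (jtheta p (u * v) * jtheta p (u / v)) -
  jtheta p (x * v) * jtheta p (x / v) * (jtheta p (u * y) * jtheta p (u / y)) =
  u / y * (jtheta p (y * v) * jtheta p (y / v) * (jtheta p (x * u) * jtheta p (x / u))).
Proof.
move=> p0 x0 y0 u0 v0 p1.
exact: (plucker_identity y0 u0 v0 (jtheta_mul p0 x0 y0 p1)
  (jtheta_mul p0 u0 v0 p1) (jtheta_mul p0 x0 v0 p1) (jtheta_mul p0 u0 y0 p1)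
  (jtheta_mul p0 y0 v0 p1) (jtheta_mul p0 x0 u0 p1)).
Qed.

Lemma clim_prod (I : Type) (s : seq I) (f : I -> nat -> C) (l : I -> C) :
  (forall i, clim (f i) (l i)) ->
  clim (fun n => \prod_(i <- s) f i n) (\prod_(i <- s) l i).
Proof.
move=> fl; elim: s => [|i s IH].
  rewrite big_nil; apply: clim_near (@clim_cst _ 1); apply: nearW => n.
  by rewrite big_nil.
rewrite big_cons; apply: clim_near (climM (fl i) IH); apply: nearW => n.
by rewrite big_cons.
Qed.

Lemma qpinf_dissect z p m : normc p < 1 -> (0 < m)%N ->
  qpinf z p = \prod_(i < m) qpinf (z * p ^+ i) (p ^+ m).
Proof.
move=> p1 m0; apply: (@clim_uniq _ (fun n => qpoch z p (m * n))).
  have h : clim (qpoch z p \o muln m) (qpinf z p).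
    apply: clim_comp (@clim_qpoch _ z p p1) => N; exists N => // n /= Nn.
    by rewrite (leq_trans Nn) // leq_pmull.
  exact: h.
have h : clim (fun n => \prod_(i < m) qpoch (z * p ^+ i) (p ^+ m) n)
    (\prod_(i < m) qpinf (z * p ^+ i) (p ^+ m)).
  by apply: clim_prod => i; apply: clim_qpoch; exact: normcX_lt1.
by apply: clim_near h; apply: nearW => n; rewrite qpoch_dissect.
Qed.

Lemma qpinfN z p : normc p < 1 ->
  qpinf z p * qpinf (- z) p = qpinf (z ^+ 2) (p ^+ 2).
Proof.
move=> p1; apply: (@clim_uniq _ (fun n => qpoch z p n * qpoch (- z) p n)).
  by apply: climM; exact: clim_qpoch.
have h := @clim_qpoch _ (z ^+ 2) (p ^+ 2) (@normcX_lt1 p 2 isT p1).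
by apply: clim_near h; apply: nearW => n; rewrite qpochN.
Qed.

Lemma eulerfE q n : eulerf q n = qpinf (q ^+ n) (q ^+ n).
Proof.
have E : (fun N => \prod_(1 <= j < N.+1) (1 - q ^+ (n * j))) = qpoch (q ^+ n) (q ^+ n).
  apply/funext => N; rewrite big_add1 /= big_mkord; apply: eq_bigr => i _.
  by rewrite exprM exprS.
exact: (congr1 (fun u : nat -> cplx R => lim (u @ \oo)%classic) E).
Qed.

End ThetaRelations.

(** * Eta quotients of level 12 *)

Section EtaAlgebra.
Variable K : fieldType.

Definition eta_identities (q f1 f2 f3 f4 f6 f12 : K) : Prop :=
  (f1 ^+ 4 * f6 ^+ 2 + f2 ^+ 2 * f3 ^+ 4
   = 2 * ((f1 ^+ 2 * f4 * f6 ^+ 9) / (f2 * f3 ^+ 2 * f12 ^+ 3))) /\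
  (f2 ^+ 2 * f3 ^+ 4 - f1 ^+ 4 * f6 ^+ 2
   = 4 * q * ((f1 * f2 ^+ 2 * f3 * f12 ^+ 3) / f4)) /\
  (f2 ^+ 9 * f3 * f12 ^+ 2 + 2 * f1 ^+ 3 * f4 ^+ 6 * f6 ^+ 3
   = 3 * f1 ^+ 2 * f2 ^+ 2 * f3 ^+ 3 * f4 ^+ 3 * f6 * f12) /\
  (f2 ^+ 9 * f3 * f12 ^+ 2 - f1 ^+ 3 * f4 ^+ 6 * f6 ^+ 3
   = 3 * q * f1 ^+ 3 * f2 ^+ 2 * f4 ^+ 2 * f6 * f12 ^+ 4) /\
  (f2 ^+ 2 * f3 ^+ 3 * f12 - f1 * f4 ^+ 3 * f6 ^+ 2
   = q * ((f1 * f2 ^+ 2 * f12 ^+ 4) / f4)) /\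
  (2 * f1 ^+ 2 * f3 ^+ 2 * f4 ^+ 3 * f6 - f2 ^+ 7 * f12
   = (f1 ^+ 4 * f4 ^+ 4 * f6 ^+ 10) / (f2 ^+ 3 * f3 ^+ 4 * f12 ^+ 3)) /\
  (4 * f3 * f4 ^+ 3 - f1 ^+ 3 * f12
   = 3 * ((f2 ^+ 2 * f3 ^+ 4 * f12) / (f1 * f6 ^+ 2))).

Lemma eta_identities_at0 : eta_identities 0 1 1 1 1 1 1.
Proof.
rewrite /eta_identities !expr1n !divff ?oner_eq0 // !mulr1 ?divr1 ?mulr1 ?mulr0 ?mul0r;
  last exact: oner_neq0.
by do ![split]; ring.
Qed.

(** Reduces each derivation of one identity from another to a single rational-function check, given
    the multiplier [c]. *)
Lemma scaled_sub_eq0 (c a b x y : K) : a = b -> x - y = c * (a - b) -> x = y.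
Proof. by move=> -> ; rewrite subrr mulr0 => /eqP; rewrite subr_eq0 => /eqP. Qed.

(** [jk] and [bk] stand for the theta values at q^k and -q^k. Multiplying the four theta relations
    by eta quotients gives identities 1, 2, 5 and 6. *)
Lemma eta_identities_of_theta (q f1 f2 f3 f4 f6 f12 j1 j2 j3 b0 b1 b2 b3 : K) :
  (2 : K) != 0 -> f1 != 0 -> f2 != 0 -> f3 != 0 -> f4 != 0 -> f6 != 0 -> f12 != 0 ->
  j1 = f1 * f6 ^+ 2 / (f2 * f3) -> j2 = f2 -> j3 = f3 ^+ 2 / f6 ->
  b0 = 2 * f12 ^+ 2 / f6 -> b1 = f2 ^+ 2 * f3 * f12 / (f1 * f4 * f6) ->
  b2 = f4 * f6 ^+ 2 / (f2 * f12) -> b3 = f6 ^+ 5 / (f3 ^+ 2 * f12 ^+ 2) ->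
  j1 ^+ 2 * j2 ^+ 2 + b1 ^+ 2 * b2 ^+ 2 = b0 * b2 * b3 ^+ 2 ->
  b1 ^+ 2 * b2 ^+ 2 - j1 ^+ 2 * j2 ^+ 2 = q * b0 ^+ 2 * b1 * b3 ->
  j3 ^+ 2 * b1 * b3 - b2 ^+ 2 * j2 ^+ 2 = q * b1 ^+ 2 * j1 ^+ 2 ->
  b0 * b2 * j3 ^+ 2 - b1 ^+ 2 * j2 ^+ 2 = b2 ^+ 2 * j1 ^+ 2 ->
  eta_identities q f1 f2 f3 f4 f6 f12.
Proof.
move=> two0 f10 f20 f30 f40 f60 f120 -> -> -> -> -> -> -> r1 r2 r5 r6.
have i1 : f1 ^+ 4 * f6 ^+ 2 + f2 ^+ 2 * f3 ^+ 4
   = 2 * ((f1 ^+ 2 * f4 * f6 ^+ 9) / (f2 * f3 ^+ 2 * f12 ^+ 3)).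
  apply: (scaled_sub_eq0 (c := f1 ^+ 2 * f3 ^+ 2 / f6 ^+ 2) r1).
  by field; rewrite ?f10 ?f20 ?f30 ?f40 ?f60 ?f120.
have i2 : f2 ^+ 2 * f3 ^+ 4 - f1 ^+ 4 * f6 ^+ 2
   = 4 * q * ((f1 * f2 ^+ 2 * f3 * f12 ^+ 3) / f4).
  apply: (scaled_sub_eq0 (c := f1 ^+ 2 * f3 ^+ 2 / f6 ^+ 2) r2).
  by field; rewrite ?f10 ?f20 ?f30 ?f40 ?f60 ?f120.
have i5 : f2 ^+ 2 * f3 ^+ 3 * f12 - f1 * f4 ^+ 3 * f6 ^+ 2
   = q * ((f1 * f2 ^+ 2 * f12 ^+ 4) / f4).
  apply: (scaled_sub_eq0 (c := f1 * f4 * f12 ^+ 2 / f6 ^+ 2) r5).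
  by field; rewrite ?f10 ?f20 ?f30 ?f40 ?f60 ?f120.
have i6 : 2 * f1 ^+ 2 * f3 ^+ 2 * f4 ^+ 3 * f6 - f2 ^+ 7 * f12
   = (f1 ^+ 4 * f4 ^+ 4 * f6 ^+ 10) / (f2 ^+ 3 * f3 ^+ 4 * f12 ^+ 3).
  apply: (scaled_sub_eq0 (c := f1 ^+ 2 * f2 * f4 ^+ 2 * f6 ^+ 2 / (f3 ^+ 2 * f12)) r6).
  by field; rewrite ?f10 ?f20 ?f30 ?f40 ?f60 ?f120.
clear r1 r2 r5 r6.
pose I1 := f1 ^+ 4 * f6 ^+ 2 + f2 ^+ 2 * f3 ^+ 4
   - 2 * ((f1 ^+ 2 * f4 * f6 ^+ 9) / (f2 * f3 ^+ 2 * f12 ^+ 3)).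
pose I2 := f2 ^+ 2 * f3 ^+ 4 - f1 ^+ 4 * f6 ^+ 2
   - 4 * q * ((f1 * f2 ^+ 2 * f3 * f12 ^+ 3) / f4).
pose I5 := f2 ^+ 2 * f3 ^+ 3 * f12 - f1 * f4 ^+ 3 * f6 ^+ 2
   - q * ((f1 * f2 ^+ 2 * f12 ^+ 4) / f4).
pose I6 := 2 * f1 ^+ 2 * f3 ^+ 2 * f4 ^+ 3 * f6 - f2 ^+ 7 * f12
   - (f1 ^+ 4 * f4 ^+ 4 * f6 ^+ 10) / (f2 ^+ 3 * f3 ^+ 4 * f12 ^+ 3).
have I10 : I1 = 0 by rewrite /I1 i1 subrr.
have I20 : I2 = 0 by rewrite /I2 i2 subrr.
have I50 : I5 = 0 by rewrite /I5 i5 subrr.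
have I60 : I6 = 0 by rewrite /I6 i6 subrr.
split; first exact: i1.
split; first exact: i2.
split.
  (* Averaging [I1] and [I2] cancels f1^4 f6^2; [I5] then removes the term in q and [I6] the
     remaining quotient with denominator f2 f3^2 f12^3. *)
  apply: (scaled_sub_eq0 (c := f1 ^+ 2 * f4 ^+ 3 * f6 * f12 / f3)
    (a := (I1 + I2) / 2 - 2 * (f3 / f12) * I5 -
          I6 * f2 ^+ 2 * f3 ^+ 2 / (f1 ^+ 2 * f4 ^+ 3 * f6)) (b := 0)).
    by rewrite I10 I20 I50 I60 !(mulr0, mul0r, addr0, subr0).
  by rewrite /I1 /I2 /I5 /I6; field; rewrite ?f10 ?f20 ?f30 ?f40 ?f60 ?f120 ?two0.
split.
  (* The same combination with coefficient 1 instead of -2 on [I5]: now f2^2 f3^4 cancels and the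
     term in q survives. *)
  apply: (scaled_sub_eq0 (c := f1 ^+ 2 * f4 ^+ 3 * f6 * f12 / f3)
    (a := (I1 + I2) / 2 + (f3 / f12) * I5 -
          I6 * f2 ^+ 2 * f3 ^+ 2 / (f1 ^+ 2 * f4 ^+ 3 * f6)) (b := 0)).
    by rewrite I10 I20 I50 I60 !(mulr0, mul0r, addr0, subr0).
  by rewrite /I1 /I2 /I5 /I6; field; rewrite ?f10 ?f20 ?f30 ?f40 ?f60 ?f120 ?two0.
split; first exact: i5.
split; first exact: i6.
(* The coefficients 4 and -f12/f3 cancel the terms in q. *)
apply: (scaled_sub_eq0 (c := - (f3 / (f1 * f6 ^+ 2)))
    (a := 4 * I5 - f12 / f3 * I2) (b := 0)).
  by rewrite I20 I50 !mulr0 subrr.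
by rewrite /I2 /I5; field; rewrite ?f10 ?f20 ?f30 ?f40 ?f60 ?f120 ?two0.
Qed.

(* [E k n] and [g k] stand for (q^k;q^n) and (-q^k;q^6). *)
Lemma theta_values (E : nat -> nat -> K) (g : nat -> K) :
  (forall n m, (0 < n)%N -> (0 < m)%N ->
    E n n = \prod_(i < m) E (n * i.+1)%N (n * m)%N) ->
  (forall k, E k 6 * g k = E (k * 2)%N 12) ->
  (forall n, (0 < n)%N -> E n n != 0) ->
  let f n := E n n in
  [/\ f 6 * (E 1 6 * E 5 6) = f 1 * f 6 ^+ 2 / (f 2 * f 3),
      f 6 * (E 2 6 * E 4 6) = f 2,
      f 6 * (E 3 6 * E 3 6) = f 3 ^+ 2 / f 6 &
      f 6 * ((1 + 1) * g 6 * g 6) = 2 * f 12 ^+ 2 / f 6] /\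
  [/\ f 6 * (g 1 * g 5) = f 2 ^+ 2 * f 3 * f 12 / (f 1 * f 4 * f 6),
      f 6 * (g 2 * g 4) = f 4 * f 6 ^+ 2 / (f 2 * f 12) &
      f 6 * (g 3 * g 3) = f 6 ^+ 5 / (f 3 ^+ 2 * f 12 ^+ 2)].
Proof.
move=> dis H E0 f.
have F1 : f 1 = E 1 6 * (E 2 6 * (E 3 6 * (E 4 6 * (E 5 6 * E 6 6)))).
  by rewrite /f (dis 1 6) // !big_ord_recl big_ord0 mulr1.
have F2 : f 2 = E 2 6 * (E 4 6 * E 6 6).
  by rewrite /f (dis 2 3) // !big_ord_recl big_ord0 mulr1.
have F3 : f 3 = E 3 6 * E 6 6 by rewrite /f (dis 3 2) // !big_ord_recl big_ord0 mulr1.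
have F4 : f 4 = E 4 12 * (E 8 12 * E 12 12).
  by rewrite /f (dis 4 3) // !big_ord_recl big_ord0 mulr1.
have F2' : f 2 = E 2 12 * (E 4 12 * (E 6 12 * (E 8 12 * (E 10 12 * E 12 12)))).
  by rewrite /f (dis 2 6) // !big_ord_recl big_ord0 mulr1.
have F6' : f 6 = E 6 12 * E 12 12.
  by rewrite /f (dis 6 2) // !big_ord_recl big_ord0 mulr1.
have F12 : f 12 = E 6 6 * g 6 by rewrite H.
move: F2' F6' (E0 1 isT) (E0 4 isT).
rewrite -/(f 1) -/(f 4) F1 F2 F3 F4 F12 -(H 1) -(H 2) -(H 3) -(H 4) -(H 5) -(H 6).
rewrite {F1 F2 F3 F4 F12 dis E0}/f.
move: (E 1 6) (E 2 6) (E 3 6) (E 4 6) (E 5 6) (E 6 6) => e1 e2 e3 e4 e5 e6.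
move: (g 1) (g 2) (g 3) (g 4) (g 5) (g 6) => g1 g2 g3 g4 g5 g6 F2' F6'.
rewrite !mulf_eq0 !negb_or.
move=> /andP[e10 /andP[e20 /andP[e30 /andP[e40 /andP[e50 e60]]]]].
move=> /andP[/andP[_ g20] /andP[/andP[_ g40] /andP[_ g60]]].
(* Expanding f6 modulo 12 gives e6 = e3 g3 e6 g6. The same comparison for f2 then determines the
   product g1 g5, and all seven values become rational in the other variables. *)
have G3 : g3 = (e3 * g6)^-1.
  apply: (mulfI (mulf_neq0 e30 (mulf_neq0 e60 g60))).
  transitivity (e3 * g3 * (e6 * g6)); first by ring.
  by rewrite -F6'; field; rewrite e30 g60.
have G1 : g1 * g5 = (e1 * e5 * g2 * g4)^-1.
  apply: (mulfI (mulf_neq0 (mulf_neq0 e10 (mulf_neq0 e20 (mulf_neq0 e40 e50)))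
    (mulf_neq0 (mulf_neq0 e60 g20) g40))).
  transitivity (e1 * g1 * (e2 * g2 * (e4 * g4 * (e5 * g5 * e6)))); first by ring.
  rewrite [X in _ = X](_ : _ = e2 * (e4 * e6)); last first.
    by field; rewrite e10 e50 g20 g40.
  by rewrite F2' {1}F6'; ring.
rewrite G1 G3; split; split;
  by field; rewrite ?e10 ?e20 ?e30 ?e40 ?e50 ?e60 ?g20 ?g40 ?g60.
Qed.

(** All arguments in the four substitutions are of the form q^k or -q^k; the reflection k to 6 - k
    and the inversion k to -k bring every exponent into 0..3. *)
Lemma theta_relations (J : K -> K) (q : K) : q != 0 ->
  (forall z : K, z != 0 -> J (q ^+ 6 / z) = J z) ->
  (forall z : K, z != 0 -> J z^-1 = - z^-1 * J z) ->
  (forall x y u v : K, x != 0 -> y != 0 -> u != 0 -> v != 0 ->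
    J (x * y) * J (x / y) * (J (u * v) * J (u / v)) -
    J (x * v) * J (x / v) * (J (u * y) * J (u / y)) =
    u / y * (J (y * v) * J (y / v) * (J (x * u) * J (x / u)))) ->
  let j1 := J q in let j2 := J (q ^+ 2) in let j3 := J (q ^+ 3) in
  let b0 := J (-1) in let b1 := J (- q) in let b2 := J (- q ^+ 2) in
  let b3 := J (- q ^+ 3) in
  [/\ j1 ^+ 2 * j2 ^+ 2 + b1 ^+ 2 * b2 ^+ 2 = b0 * b2 * b3 ^+ 2,
      b1 ^+ 2 * b2 ^+ 2 - j1 ^+ 2 * j2 ^+ 2 = q * b0 ^+ 2 * b1 * b3,
      j3 ^+ 2 * b1 * b3 - b2 ^+ 2 * j2 ^+ 2 = q * b1 ^+ 2 * j1 ^+ 2 &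
      b0 * b2 * j3 ^+ 2 - b1 ^+ 2 * j2 ^+ 2 = b2 ^+ 2 * j1 ^+ 2].
Proof.
move=> q0 JC JV W j1 j2 j3 b0 b1 b2 b3.
(* A sign bit and an integer exponent encode the arguments, so that products and quotients reduce to
   computations on bits and integers. *)
pose j (s : bool) (k : int) := J ((-1) ^+ s * q ^ k).
have p0 (s : bool) (k : int) : (-1) ^+ s * q ^ k != 0 by rewrite mulf_neq0 ?signr_eq0 ?expfz_neq0.
have pM (s t : bool) (k l : int) : (-1) ^+ s * q ^ k * ((-1) ^+ t * q ^ l) =
    (-1) ^+ (s (+) t) * q ^ (k + l).
  by rewrite signr_addb expfzDr //; ring.
have pV (s : bool) (k : int) : ((-1) ^+ s * q ^ k)^-1 = (-1) ^+ s * q ^ (- k).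
  by rewrite invfM invr_sign invr_expz.
have pD (s t : bool) (k l : int) : (-1) ^+ s * q ^ k / ((-1) ^+ t * q ^ l) =
    (-1) ^+ (s (+) t) * q ^ (k - l) by rewrite pV pM.
have jC s k : j s (6 - k) = j s k.
  by rewrite /j -[RHS](JC _ (p0 s k)) pV mulrCA [q ^+ 6]exprnP -expfzDr.
have jV s k : j s (- k) = - ((-1) ^+ s * q ^ (- k)) * j s k.
  by rewrite /j -pV JV.
have jW s k t l s' k' t' l' :
    j (s (+) t) (k + l) * j (s (+) t) (k - l) *
      (j (s' (+) t') (k' + l') * j (s' (+) t') (k' - l')) -
    j (s (+) t') (k + l') * j (s (+) t') (k - l') *
      (j (s' (+) t) (k' + l) * j (s' (+) t) (k' - l)) =
    (-1) ^+ (s' (+) t) * q ^ (k' - l) *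
      (j (t (+) t') (l + l') * j (t (+) t') (l - l') *
      (j (s (+) s') (k + k') * j (s (+) s') (k - k'))).
  rewrite /j -!pD -!pM; exact: W.
have J1 : j false 1 = j1 by rewrite /j mul1r.
have J2 : j false 2 = j2 by rewrite /j mul1r.
have J3 : j false 3 = j3 by rewrite /j mul1r.
have B0 : j true 0 = b0 by rewrite /j mulr1.
have B1 : j true 1 = b1 by rewrite /j mulN1r.
have B2 : j true 2 = b2 by rewrite /j mulN1r.
have B3 : j true 3 = b3 by rewrite /j mulN1r.
have J4 : j false 4 = j2 by rewrite -J2 -jC.
have J5 : j false 5 = j1 by rewrite -J1 -jC.
have B4 : j true 4 = b2 by rewrite -B2 -jC.
have B5 : j true 5 = b1 by rewrite -B1 -jC.
have B6 : j true 6 = b0 by rewrite -B0 -jC.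
have JV1 : j false (-1) = - q^-1 * j1 by rewrite jV J1 mul1r.
have JV2 : j false (-2) = - q ^- 2 * j2 by rewrite jV J2 mul1r.
have JV3 : j false (-3) = - q ^- 3 * j3 by rewrite jV J3 mul1r.
have BV1 : j true (-1) = q^-1 * b1 by rewrite jV B1 mulN1r opprK.
have BV2 : j true (-2) = q ^- 2 * b2 by rewrite jV B2 mulN1r opprK.
have BV3 : j true (-3) = q ^- 3 * b3 by rewrite jV B3 mulN1r opprK.
split.
- have : j false 2 * j false (-2) * (j false 5 * j false (-1)) -
         j true 3 * j true (-3) * (j true 4 * j true 0) =
         -1 * 1 * (j true 5 * j true (-1) * (j true 2 * j true (-2))).
    exact: (jW false 0 false 2 true 2 true 3).
  rewrite J2 JV2 J5 JV1 B3 BV3 B4 B0 B5 BV1 B2 BV2 => r.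
  (* The multiplier clears the negative powers of q produced by inversion; in the next three cases
     it also fixes the sign. *)
  by apply: (scaled_sub_eq0 (c := q ^+ 3) r); field.
- have : j false 4 * j false (-2) * (j false 5 * j false (-1)) -
         j true 4 * j true (-2) * (j true 5 * j true (-1)) =
         -1 * q^-1 * (j true 6 * j true 0 * (j true 3 * j true (-1))).
    exact: (jW false 1 false 3 true 2 true 3).
  rewrite J4 JV2 J5 JV1 B4 BV2 B5 BV1 B6 B0 B3 => r.
  by apply: (scaled_sub_eq0 (c := - q ^+ 3) r); field.
- have : j false 3 * j false (-3) * (j true 3 * j true (-1)) -
         j true 2 * j true (-2) * (j false 4 * j false (-2)) =
         1 * q ^- 2 * (j true 5 * j true 1 * (j false 1 * j false (-1))).
    exact: (jW false 0 false 3 false 1 true 2).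
  rewrite J3 JV3 B3 BV1 B2 BV2 J4 JV2 B5 B1 J1 JV1 => r.
  by apply: (scaled_sub_eq0 (c := - q ^+ 4) r); field.
have : j false 3 * j false (-3) * (j true 4 * j true 0) -
       j true 2 * j true (-2) * (j false 5 * j false (-1)) =
       1 * q^-1 * (j true 5 * j true 1 * (j false 2 * j false (-2))).
  exact: (jW false 0 false 3 false 2 true 2).
rewrite J3 JV3 B4 B0 B2 BV2 J5 JV1 B5 B1 J2 JV2 => r.
by apply: (scaled_sub_eq0 (c := - q ^+ 3) r); field.
Qed.
End EtaAlgebra.

(** * Specialization to infinite products in powers of q *)

Section Monomials.
Variable K : fieldType.
Implicit Type q : K.

Lemma sqr_cube q : (q ^+ 3) ^+ 2 = q ^+ 6. Proof. by rewrite -exprM. Qed.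

Lemma expr_div6 q k : q != 0 -> (k <= 6)%N -> q ^+ 6 / q ^+ k = q ^+ (6 - k).
Proof. by move=> q0 k6; rewrite -expfB_cond // (negPf q0). Qed.

Lemma expr_div6N q k : q != 0 -> (k <= 6)%N -> q ^+ 6 / (- q ^+ k) = - q ^+ (6 - k).
Proof. by move=> q0 k6; rewrite invrN mulrN expr_div6. Qed.
End Monomials.

Section EtaQuotients.
Variable R : realType.
Local Notation C := R[i].
Variable q : C.
Hypothesis q1 : normc q < 1.

Lemma qpinf_dissect_expr n m : (0 < n)%N -> (0 < m)%N ->
  qpinf (q ^+ n) (q ^+ n) = \prod_(i < m) qpinf (q ^+ (n * i.+1)) (q ^+ (n * m)).
Proof.
move=> n0 m0; rewrite (qpinf_dissect (q ^+ n) (normcX_lt1 n0 q1) m0).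
apply: eq_bigr => i _.
by rewrite -!exprM -exprD -mulnS.
Qed.

Lemma qpinfN_expr k : qpinf (q ^+ k) (q ^+ 6) * qpinf (- q ^+ k) (q ^+ 6) =
  qpinf (q ^+ (k * 2)) (q ^+ 12).
Proof. by rewrite (qpinfN _ (@normcX_lt1 _ q 6 isT q1)) -!exprM. Qed.

Lemma jtheta_cube_expr k : q != 0 -> (k <= 6)%N ->
  jtheta (q ^+ 3) (q ^+ k) =
  qpinf (q ^+ 6) (q ^+ 6) * (qpinf (q ^+ k) (q ^+ 6) * qpinf (q ^+ (6 - k)) (q ^+ 6)).
Proof. by move=> q0 k6; rewrite /jtheta sqr_cube (expr_div6 q0 k6). Qed.

Lemma jtheta_cube_exprN k : q != 0 -> (k <= 6)%N ->
  jtheta (q ^+ 3) (- q ^+ k) =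
  qpinf (q ^+ 6) (q ^+ 6) *
    (qpinf (- q ^+ k) (q ^+ 6) * qpinf (- q ^+ (6 - k)) (q ^+ 6)).
Proof. by move=> q0 k6; rewrite /jtheta sqr_cube (expr_div6N q0 k6). Qed.

Lemma qpinfN1 : qpinf (-1) (q ^+ 6) = (1 + 1) * qpinf (- q ^+ 6) (q ^+ 6).
Proof. by rewrite (qpinf_rec _ (@normcX_lt1 _ q 6 isT q1)) opprK mulrN1. Qed.

Lemma eta_identities_qpinf : q != 0 ->
  let f n := qpinf (q ^+ n) (q ^+ n) in
  eta_identities q (f 1%N) (f 2%N) (f 3%N) (f 4%N) (f 6%N) (f 12%N).
Proof.
move=> q0 f.
have f0 n : (0 < n)%N -> f n != 0.
  by move=> n0; exact: (qpinf_neq0 (normcX_lt1 n0 q1)).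
have [[J1 J2 J3 B0] [B1 B2 B3]] := @theta_values _ (fun k n => qpinf (q ^+ k) (q ^+ n))
  (fun k => qpinf (- q ^+ k) (q ^+ 6)) qpinf_dissect_expr qpinfN_expr f0.
have p0 : q ^+ 3 != 0 := expf_neq0 3 q0.
have p1 : normc (q ^+ 3) < 1 := @normcX_lt1 _ q 3 isT q1.
have JC z : z != 0 -> jtheta (q ^+ 3) (q ^+ 6 / z) = jtheta (q ^+ 3) z.
  by move=> z0; rewrite -(jthetaC p0 z0) sqr_cube.
have [r1 r2 r5 r6] := theta_relations q0 JC (fun z z0 => jthetaV p0 z0 p1)
  (fun x y u v x0 y0 u0 v0 => weierstrass_relation p0 x0 y0 u0 v0 p1).
have two0 : (2 : C) != 0 by rewrite pnatr_eq0.
apply: (eta_identities_of_theta two0 (f0 1%N isT) (f0 2 isT) (f0 3 isT) (f0 4 isT)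
  (f0 6 isT) (f0 12 isT) _ _ _ _ _ _ _ r1 r2 r5 r6).
- exact: (etrans (@jtheta_cube_expr 1 q0 isT) J1).
- exact: (etrans (@jtheta_cube_expr 2 q0 isT) J2).
- exact: (etrans (@jtheta_cube_expr 3 q0 isT) J3).
(* At exponent 0 the first factor 1 + 1 is split off, which turns the product at -1 into twice the
   product at -q^6. *)
- have h := @jtheta_cube_exprN 0 q0 isT; rewrite expr0 qpinfN1 in h.
  exact: (etrans h B0).
- exact: (etrans (@jtheta_cube_exprN 1 q0 isT) B1).
- exact: (etrans (@jtheta_cube_exprN 2 q0 isT) B2).
- exact: (etrans (@jtheta_cube_exprN 3 q0 isT) B3).
Qed.
End EtaQuotients.

Lemma eulerf0 (R : realType) n : (0 < n)%N -> eulerf (0 : R[i]) n = 1.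
Proof.
move=> n0; rewrite eulerfE expr0n -[n]prednK //=; apply: clim_lim.
apply: clim_near (@clim_cst _ 1); apply: nearW => N.
by rewrite /qpoch big1 // => i _; rewrite mul0r subr0.
Qed.

Theorem lemma4p1 (R : realType) (q : R[i]) (hq : `|q| < 1) :
  let f1 : R[i] := eulerf q 1 in
  let f2 : R[i] := eulerf q 2 in
  let f3 : R[i] := eulerf q 3 in
  let f4 : R[i] := eulerf q 4 in
  let f6 : R[i] := eulerf q 6 in
  let f12 : R[i] := eulerf q 12 in
  (f1 ^+ 4 * f6 ^+ 2 + f2 ^+ 2 * f3 ^+ 4
   = 2 * ((f1 ^+ 2 * f4 * f6 ^+ 9) / (f2 * f3 ^+ 2 * f12 ^+ 3))) /\
  (f2 ^+ 2 * f3 ^+ 4 - f1 ^+ 4 * f6 ^+ 2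
   = 4 * q * ((f1 * f2 ^+ 2 * f3 * f12 ^+ 3) / f4)) /\
  (f2 ^+ 9 * f3 * f12 ^+ 2 + 2 * f1 ^+ 3 * f4 ^+ 6 * f6 ^+ 3
   = 3 * f1 ^+ 2 * f2 ^+ 2 * f3 ^+ 3 * f4 ^+ 3 * f6 * f12) /\
  (f2 ^+ 9 * f3 * f12 ^+ 2 - f1 ^+ 3 * f4 ^+ 6 * f6 ^+ 3
   = 3 * q * f1 ^+ 3 * f2 ^+ 2 * f4 ^+ 2 * f6 * f12 ^+ 4) /\
  (f2 ^+ 2 * f3 ^+ 3 * f12 - f1 * f4 ^+ 3 * f6 ^+ 2
   = q * ((f1 * f2 ^+ 2 * f12 ^+ 4) / f4)) /\
  (2 * f1 ^+ 2 * f3 ^+ 2 * f4 ^+ 3 * f6 - f2 ^+ 7 * f12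
   = (f1 ^+ 4 * f4 ^+ 4 * f6 ^+ 10) / (f2 ^+ 3 * f3 ^+ 4 * f12 ^+ 3)) /\
  (4 * f3 * f4 ^+ 3 - f1 ^+ 3 * f12
   = 3 * ((f2 ^+ 2 * f3 ^+ 4 * f12) / (f1 * f6 ^+ 2))).
Proof.
have q1 : normc q < 1 by rewrite -ltcR.
suff : eta_identities q (eulerf q 1) (eulerf q 2) (eulerf q 3) (eulerf q 4)
  (eulerf q 6) (eulerf q 12) by [].
(* The theta series involve negative powers of q, so q = 0 is treated apart; there every Euler
   product equals 1. *)
have [->|q0] := eqVneq q 0.
  rewrite !eulerf0 //; exact: eta_identities_at0.
rewrite !eulerfE; exact: eta_identities_qpinf.
Qed.
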